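(* Let $a\ge 2$ be an integer. Then the generalized degree polynomial $\mathbf{G}_T$ of a tree $T$ determines each of the following quantities (i.e., any two trees with equal generalized degree polynomials have equal values of them): (i) $N_{a,a,1}(T)+N_{a,a,2}(T)+\dots+N_{a,a,a-1}(T)$; (ii) $N_{a,a,a-k}(T)-N_{a,a,a+k}(T)$ for every $1\le k\le a-1$; (iii) $N_{a,a,b}(T)$ for every $b\ge 2a$.
   Context: All graphs are finite and simple. For a tree $T$ and $A\subseteq V(T)$, $e(A)$ is the number of edges of $T$ with both endpoints in $A$ and $d(A)$ the number with exactly one endpoint in $A$; $\mathbf{G}_T(x,y,z)=\sum_{A\subseteq V(T)} x^{|A|}y^{d(A)}z^{e(A)}$. For positive integers $a_1,a_2,a_3$, $N_{a_1,a_2,a_3}(T)$ is the number of paths $(v_1,v_2,v_3)$ in $T$ with $\deg_T(v_i)=a_i$ for $i=1,2,3$, counted up to reversal when $a_1=a_3$. *)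

(* Defs.v *)
From HB Require Import structures.
From mathcomp Require Import all_boot all_order all_algebra.
From mathcomp Require Import mpoly.

Set Implicit Arguments.
Unset Strict Implicit.
Unset Printing Implicit Defensive.

Record sgraph := SGraph {
  vertex :> finType;
  adj : rel vertex;
  adj_sym : ssrbool.symmetric adj;
  adj_irrefl : irreflexive adj
}.

(* In a simple graph a duplicate-free adj-cycle of size 2 just runs back and
   forth along an edge, so genuine graph cycles are those of size >= 3. *)
Definition acyclic (G : sgraph) : Prop :=
  forall c : seq G, ucycle (@adj G) c -> size c < 3.

Definition connected (G : sgraph) : Prop :=
  0 < #|G| /\ forall x y : G, connect (@adj G) x y.

Definition is_tree (G : sgraph) : Prop := connected G /\ acyclic G.

Definition edges (G : sgraph) : {set {set G}} :=
  [set [set x; y] | x in G, y in G & adj x y].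

Definition deg (G : sgraph) (v : G) : nat := #|[set w | adj v w]|.

Definition inner_edges (G : sgraph) (A : {set G}) : nat :=
  #|[set f in edges G | f \subset A]|.

Definition boundary_edges (G : sgraph) (A : {set G}) : nat :=
  #|[set f in edges G | #|f :&: A| == 1]|.

(* The variables x, y, z are 'X_0, 'X_1, 'X_2. *)
Definition gen_degree_poly (G : sgraph) : {mpoly int[3]} :=
  (\sum_(A : {set G})
     'X_(inord 0%N) ^+ #|A| * 'X_(inord 1) ^+ boundary_edges A
       * 'X_(inord 2%N) ^+ inner_edges A)%R.

Definition deg_paths (G : sgraph) (a1 a2 a3 : nat) : {set G * G * G} :=
  [set p | let: (v1, v2, v3) := p in
     [&& uniq [:: v1; v2; v3], adj v1 v2, adj v2 v3,
         deg v1 == a1, deg v2 == a2 & deg v3 == a3]].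

Definition rev_path (V : finType) (p : V * V * V) : V * V * V :=
  let: (v1, v2, v3) := p in (v3, v2, v1).

(* For a1 = a3 the set deg_paths is stable under reversal, and its reversal
   classes {p, rev_path p} are counted. *)
Definition Npaths (a1 a2 a3 : nat) (G : sgraph) : nat :=
  if a1 == a3 then #|[set [set p; rev_path p] | p in deg_paths G a1 a2 a3]|
  else #|deg_paths G a1 a2 a3|.

(* Main.v *)
Require Import Defs.
From mathcomp Require Import all_boot all_order all_algebra.
From mathcomp Require Import mpoly ring lra zify.

Set Implicit Arguments.
Unset Strict Implicit.
Unset Printing Implicit Defensive.

Import GRing.Theory.

(** Write [X_v = x y^(deg v)].  Counting the edges inside and across [A] by their
    endpoints gives [d(A) + 2 e(A) = sum_(v in A) deg v], so [G_T] determines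
    [sum_A e(A)^k prod_(v in A) X_v] for [k = 0, 1, 2].  These are, up to the
    factor [prod_v (1 + X_v)], the moments of the number of edges spanned by a
    random set containing each [v] independently with "probability"
    [g_v = X_v / (1 + X_v)].  In the variance only pairs of intersecting edges
    survive, so it is a combination of [g_u g_v - (g_u g_v)^2] over edges and
    [g_u g_v g_w (1 - g_v)] over paths [u v w].

    Take [y = q] rational and expand in [t = 1 + x q^a]: only degree [a]
    vertices have a pole at [t = 0].  The pole of order 3 comes from the edges
    [(a,a)] and the paths [(a,a,a)], whose numbers can be read off from the
    leading poles of mean and variance, and from the paths [(a,a,b)], [b <> a],
    weighted by [q^b / (q^b - q^a)].  With [L_m = q^m / (1 - q^m)] this weight is
    [1 + L_m] for [b = a - m] and [- L_m] for [b = a + m]; since [1, L_1, L_2, ...]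
    are linearly independent functions of [q], the three claims follow. *)

(** * The polynomial as a record of subset statistics *)

Section GenDegreePoly.
Local Open Scope ring_scope.

Definition set_stat (G : sgraph) (A : {set G}) : nat * nat * nat :=
  (#|A|, boundary_edges A, inner_edges A).

Definition stat_monomial (s : nat * nat * nat) : 'X_{1..3} :=
  (U_(inord 0%N) *+ s.1.1 + U_(inord 1) *+ s.1.2 + U_(inord 2) *+ s.2)%MM.

Lemma stat_monomial_inj : injective stat_monomial.
Proof.
move=> [[i j] k] [[i' j'] k'] /mnmP eq_m.
have := (eq_m (inord 0%N), eq_m (inord 1%N), eq_m (inord 2%N)).
rewrite !mnmDE !mulmnE !mnm1E -!val_eqE /= !inordK //=.
rewrite !mul0n !mul1n !addn0 !add0n.
by case=> [[-> ->] ->].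
Qed.

Lemma gen_degree_polyE (G : sgraph) :
  gen_degree_poly G = \sum_(A : {set G}) 'X_[stat_monomial (set_stat A)].
Proof.
by apply: eq_bigr => A _; rewrite /stat_monomial !mpolyXD !mpolyXn.
Qed.

Lemma mcoeff_gen_degree_poly (G : sgraph) (s : nat * nat * nat) :
  (gen_degree_poly G)@_(stat_monomial s) =
  (count_mem s [seq set_stat A | A : {set G}])%:Z.
Proof.
rewrite gen_degree_polyE raddf_sum /= -sum1_count big_map big_enum_cond /=.
rewrite -natz natr_sum [RHS]big_mkcond /=; apply: eq_bigr => A _.
by rewrite mcoeffX (inj_eq stat_monomial_inj); case: eqP.
Qed.

Lemma perm_set_stat (G1 G2 : sgraph) :
  gen_degree_poly G1 = gen_degree_poly G2 ->
  perm_eq [seq set_stat A | A : {set G1}] [seq set_stat A | A : {set G2}].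
Proof.
move=> eqG; apply/allP => s _ /=.
by rewrite -eqz_nat -!mcoeff_gen_degree_poly eqG.
Qed.

(** Distinct statistics give distinct monomials, so the coefficients count subsets by statistics.
    Equality of the polynomials is exploited only in this form. *)
Lemma sum_set_stat (G1 G2 : sgraph) (R : nmodType) (f : nat * nat * nat -> R) :
  gen_degree_poly G1 = gen_degree_poly G2 ->
  \sum_(A : {set G1}) f (set_stat A) = \sum_(A : {set G2}) f (set_stat A).
Proof.
move=> /perm_set_stat perm12.
transitivity (\sum_(s <- [seq set_stat A | A : {set G1}]) f s).
  by rewrite big_map big_enum.
by rewrite (perm_big _ perm12) big_map big_enum.
Qed.

End GenDegreePoly.

(** * Edge counts as sums over ordered adjacent pairs *)

Section Handshake.
Variable G : sgraph.

(** The fibre of [p |-> [set p.1; p.2]] over an edge consists of its two directions. Edge sums below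
    run over ordered pairs, which is why doubled counts appear. *)
Lemma sum_adj_edges (R : nmodType) (F : {set G} -> R) :
  (\sum_(p : G * G | adj p.1 p.2) F [set p.1; p.2]
   = \sum_(f in edges G) F f *+ 2)%R.
Proof.
rewrite (partition_big (fun p : G * G => [set p.1; p.2]) (mem (edges G))) /=;
  last by move=> [x y] /= xy; apply/imset2P; exists x y; rewrite ?inE.
apply: eq_bigr => f /imset2P [x y _]; rewrite inE /= => xy ->.
have neq : x != y by apply: contraTneq xy => ->; rewrite adj_irrefl.
rewrite (bigD1 (x, y)) /=; last by rewrite xy eqxx.
rewrite (bigD1 (y, x)) /=; last first.
  by rewrite adj_sym xy setUC eqxx xpair_eqE negb_and eq_sym neq.
rewrite (setUC [set y]) big1 ?addr0 ?mulr2n // => [[u v]] /=.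
rewrite !xpair_eqE /= => /andP [/andP [/andP [uv /eqP eqf]]].
have : u \in [set x; y] by rewrite -eqf set21.
have : v \in [set x; y] by rewrite -eqf set22.
rewrite !inE => /orP [] /eqP Ev /orP [] /eqP Eu; move: uv;
  by rewrite Eu Ev ?adj_irrefl ?eqxx //= => _ //= _.
Qed.

Lemma double_inner_edges (A : {set G}) :
  (inner_edges A).*2 =
  \sum_(p : G * G | adj p.1 p.2) ([set p.1; p.2] \subset A).
Proof.
rewrite (sum_adj_edges (fun f => f \subset A : nat)) /inner_edges -muln2.
rewrite -sum1dep_card big_mkcondr /= big_distrl /=.
by apply: eq_bigr => f _; case: ifP.
Qed.

Lemma double_boundary_edges (A : {set G}) :
  (boundary_edges A).*2 =
  \sum_(p : G * G | adj p.1 p.2) (#|[set p.1; p.2] :&: A| == 1).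
Proof.
rewrite (sum_adj_edges (fun f => #|f :&: A| == 1 : nat)) /boundary_edges -muln2.
rewrite -sum1dep_card big_mkcondr /= big_distrl /=.
by apply: eq_bigr => f _; case: ifP.
Qed.

Lemma sum_deg_adj (A : {set G}) :
  \sum_(v in A) deg v = \sum_(p : G * G | adj p.1 p.2) (p.1 \in A).
Proof.
rewrite -(pair_big_dep xpredT (fun u v => adj u v) (fun u _ => nat_of_bool (u \in A))) /=.
rewrite big_mkcond; apply: eq_bigr => v _ /=.
rewrite sum_nat_const /deg cardsE; case: ifP => _; by rewrite ?muln1 ?muln0.
Qed.

Lemma sum_deg (A : {set G}) :
  \sum_(v in A) deg v = boundary_edges A + (inner_edges A).*2.
Proof.
apply: double_inj; rewrite doubleD double_boundary_edges double_inner_edges.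
have swap : \sum_(v in A) deg v = \sum_(p : G * G | adj p.1 p.2) (p.2 \in A).
  rewrite sum_deg_adj (reindex_inj (h := fun p : G * G => (p.2, p.1))) /=.
    by apply: eq_bigl => p; rewrite adj_sym.
  by move=> [? ?] [? ?] /= [-> ->].
(* Both forms of the degree sum are added, which leaves a check per pair: the number of ends in [A]
   is 1 for a boundary edge and 2 for an inner one. *)
rewrite -addnn {1}sum_deg_adj swap.
rewrite -mul2n big_distrr -!big_split /=; apply: eq_bigr => -[u v] /= uv.
have neq : u != v by apply: contraTneq uv => ->; rewrite adj_irrefl.
have -> : #|[set u; v] :&: A| = (u \in A) + (v \in A).
  rewrite -sum1_card (eq_bigl (fun w => (w \in [set u; v]) && (w \in A))).
    by rewrite big_mkcondr big_setU1 ?inE //= big_set1; do 2!case: (_ \in A).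
  by move=> w; rewrite !inE.
by rewrite subUset !sub1set; do 2!case: (_ \in A).
Qed.

End Handshake.

(** * Random subsets with independent vertices *)

Section Moments.
Local Open Scope ring_scope.
Variables (V : finType) (K : fieldType) (X : V -> K).
Hypothesis X_neq : forall v, 1 + X v != 0.

Let g (v : V) : K := X v / (1 + X v).

(** Up to the normalising product, this is the probability that the random set contains [B]. *)
Lemma sum_supersets (B : {set V}) :
  \sum_(A : {set V}) (B \subset A)%:R * \prod_(v in A) X v =
  (\prod_v (1 + X v)) * \prod_(v in B) g v.
Proof.
rewrite [X in _ * X]big_mkcond -big_split /=.
(* Expanding this product takes [X v] for [v] in [A] and the indicator outside [A]; a term survives
   exactly when [B] is contained in [A]. *)
transitivity (\prod_v (X v + (v \notin B)%:R)); last first.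
  apply: eq_bigr => v _; case: (v \in B) => /=.
    by rewrite addr0 /g mulrC divfK.
  by rewrite mulr1 addrC.
rewrite bigA_distr; apply: eq_bigr => A _.
have [/subsetP sBA|/subsetPn [v vB vA]] := boolP (B \subset A).
  rewrite mul1r big_mkcond /=; apply: eq_bigr => v _; case: ifPn => // vA.
  by rewrite (contra (sBA v) vA).
by rewrite mul0r (bigD1 v) //= (negPf vA) vB mul0r.
Qed.

Lemma prod_set2 (u v : V) : u != v -> \prod_(w in [set u; v]) g w = g u * g v.
Proof. by move=> neq; rewrite big_setU1 ?inE // big_set1. Qed.

End Moments.

(** * First two moments of the number of spanned edges *)

Section EdgeMoments.
Local Open Scope ring_scope.
Variables (G : sgraph) (K : fieldType) (X : G -> K).
Hypothesis X_neq : forall v, 1 + X v != 0.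

Let g (v : G) : K := X v / (1 + X v).

Lemma first_moment :
  \sum_(A : {set G}) (inner_edges A).*2%:R * \prod_(v in A) X v =
  (\prod_v (1 + X v)) * \sum_(p : G * G | adj p.1 p.2) g p.1 * g p.2.
Proof.
under [LHS]eq_bigr => A _ do rewrite double_inner_edges natr_sum mulr_suml.
rewrite exchange_big mulr_sumr; apply: eq_bigr => -[u v] /= uv.
rewrite sum_supersets // prod_set2 //.
by apply: contraTneq uv => ->; rewrite adj_irrefl.
Qed.

(** Containing two edges means containing their union, so a shared vertex contributes its factor
    [g v] only once. *)
Lemma second_moment :
  \sum_(A : {set G}) (inner_edges A).*2%:R ^+ 2 * \prod_(v in A) X v =
  (\prod_v (1 + X v)) *
  \sum_(p : G * G | adj p.1 p.2) \sum_(r : G * G | adj r.1 r.2)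
     \prod_(v in [set p.1; p.2] :|: [set r.1; r.2]) g v.
Proof.
have sq (A : {set G}) : (inner_edges A).*2%:R ^+ 2 =
    \sum_(p : G * G | adj p.1 p.2) \sum_(r : G * G | adj r.1 r.2)
      ([set p.1; p.2] :|: [set r.1; r.2] \subset A)%:R :> K.
  rewrite double_inner_edges natr_sum expr2 big_distrlr /=.
  apply: eq_bigr => p _; apply: eq_bigr => r _.
  by rewrite [in RHS]subUset -mulnb natrM.
under [LHS]eq_bigr => A _ do rewrite sq mulr_suml.
rewrite exchange_big mulr_sumr; apply: eq_bigr => p _.
under [LHS]eq_bigr => A _ do rewrite mulr_suml.
rewrite exchange_big mulr_sumr; apply: eq_bigr => r _.
exact: sum_supersets.
Qed.

End EdgeMoments.

(** * The variance as a sum over edges and paths *)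

Section Covariance.
Local Open Scope ring_scope.

Lemma sum_pair_fst (I : finType) (R : nmodType) (P Q : pred (I * I)) (v : I)
    (F : I * I -> R) :
  \sum_(r | P r && (Q r && (r.1 == v))) F r =
  \sum_(w | P (v, w) && Q (v, w)) F (v, w).
Proof.
rewrite (reindex_onto (pair v) snd) /=; last by move=> [x y] /and3P [_ _ /eqP <-].
by apply: eq_bigl => w; rewrite !eqxx !andbT.
Qed.

Lemma sum_pair_snd (I : finType) (R : nmodType) (P Q : pred (I * I)) (v : I)
    (F : I * I -> R) :
  \sum_(r | P r && (Q r && (r.2 == v))) F r =
  \sum_(w | P (w, v) && Q (w, v)) F (w, v).
Proof.
rewrite (reindex_onto (pair^~ v) fst) /=; last by move=> [x y] /and3P [_ _ /eqP <-].
by apply: eq_bigl => w; rewrite !eqxx !andbT.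
Qed.

Variables (G : sgraph) (K : comNzRingType) (g : G -> K).

(** Covariance of the edges [u v] and [v w] meeting only in [v]: the joint term [g u * g v * g w]
    minus the product of the means, where [g v] is squared. *)
Definition path_weight (u v w : G) : K := g u * g v * g w * (1 - g v).

Definition edge_cov (p r : G * G) : K :=
  \prod_(v in [set p.1; p.2] :|: [set r.1; r.2]) g v
  - g p.1 * g p.2 * (g r.1 * g r.2).

(** A conditional, so that [big_mkcondr] can turn it into a filter on the sum over [r]. *)
Let cond (b : bool) (x : K) : K := if b then x else 0.

Lemma prod_set3 (a b c : G) : a != b -> a != c -> b != c ->
  \prod_(v in [set a; b; c]) g v = g a * g b * g c.
Proof.
move=> ab ac bc; rewrite setUC big_setU1 /=; last first.
  by rewrite !inE negb_or ![c == _]eq_sym ac bc.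
by rewrite big_setU1 ?inE //= big_set1 mulrC.
Qed.

(** Disjoint edges are uncorrelated. Otherwise [r] is the same edge in one of two directions, or
    shares one end in one of four positions; the inequalities keep these cases apart. *)
Lemma edge_covE (u v : G) (r : G * G) : u != v -> r.1 != r.2 ->
  edge_cov (u, v) r =
    cond (r == (u, v)) (g u * g v - (g u * g v) ^+ 2)
  + cond (r == (v, u)) (g u * g v - (g u * g v) ^+ 2)
  + cond ((r.2 != u) && (r.1 == v)) (path_weight u v r.2)
  + cond ((r.1 != u) && (r.2 == v)) (path_weight u v r.1)
  + cond ((r.2 != v) && (r.1 == u)) (path_weight v u r.2)
  + cond ((r.1 != v) && (r.2 == u)) (path_weight v u r.1).
Proof.
case: r => a b /=.
rewrite /edge_cov /path_weight /cond /= !xpair_eqE => uv ab.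
have vu : v != u by rewrite eq_sym.
have ba : b != a by rewrite eq_sym.
have [au|au] := eqVneq a u; have [bv|bv] := eqVneq b v.
- subst a b; rewrite setUid (negPf uv) (negPf vu) ?eqxx /=.
  by rewrite big_setU1 ?inE //= big_set1; ring.
- subst a; rewrite ?(negPf uv) ?(negPf ba) /=.
  have -> : [set u; v] :|: [set u; b] = [set v; u; b].
    by apply/setP => x; rewrite !inE; case: (x == u); case: (x == v); case: (x == b).
  by rewrite prod_set3 // 1?eq_sym //; ring.
- subst b; rewrite ?(negPf vu) ?(negPf ab) /=.
  have -> : [set u; v] :|: [set a; v] = [set u; v; a].
    by apply/setP => x; rewrite !inE; case: (x == u); case: (x == v); case: (x == a).
  by rewrite prod_set3 // 1?eq_sym //; ring.
have [av|av] := eqVneq a v; have [bu|bu] := eqVneq b u; rewrite /=.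
- subst a b; rewrite [X in _ :|: X]setUC setUid.
  by rewrite big_setU1 ?inE //= big_set1; ring.
- subst a.
  have -> : [set u; v] :|: [set v; b] = [set u; v; b].
    by apply/setP => x; rewrite !inE; case: (x == u); case: (x == v); case: (x == b).
  by rewrite prod_set3 // 1?eq_sym //; ring.
- subst b.
  have -> : [set u; v] :|: [set a; u] = [set v; u; a].
    by apply/setP => x; rewrite !inE; case: (x == u); case: (x == v); case: (x == a).
  by rewrite prod_set3 // 1?eq_sym //; ring.
have [ua va ub vb] : [/\ u != a, v != a, u != b & v != b].
  by split; rewrite eq_sym.
rewrite -setUA !big_setU1 ?inE ?negb_or ?uv ?ua ?ub ?va ?vb //= big_set1.
ring.
Qed.

(** For fixed [p], the two directions of [r] give the factor 2 on edges; together with the choice of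
    the shared end they give the factor 4 on paths. *)
Lemma sum_edge_cov :
  \sum_(p : G * G | adj p.1 p.2) \sum_(r : G * G | adj r.1 r.2) edge_cov p r =
  (\sum_(p : G * G | adj p.1 p.2) (g p.1 * g p.2 - (g p.1 * g p.2) ^+ 2)) *+ 2
  + (\sum_(p : G * G | adj p.1 p.2) \sum_(w | adj p.2 w && (w != p.1))
       path_weight p.1 p.2 w) *+ 4.
Proof.
have adj_neq (u v : G) : adj u v -> u != v.
  by move=> uv; apply: contraTneq uv => ->; rewrite adj_irrefl.
pose S (p : G * G) := \sum_(w | adj p.2 w && (w != p.1)) path_weight p.1 p.2 w.
have swap : \sum_(p : G * G | adj p.1 p.2) S p =
            \sum_(p : G * G | adj p.1 p.2) S (p.2, p.1).
  rewrite (reindex_inj (h := fun p : G * G => (p.2, p.1))) /=.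
    by apply: eq_bigl => p; rewrite adj_sym.
  by move=> [? ?] [? ?] /= [-> ->].
(* Two of the four path sums are recentred at [p.1], to match [edge_covE] pair by pair. *)
rewrite (mulrnDr _ 2 2) {2}swap -!mulrnDl -!big_split -sumrMnl /=.
apply: eq_bigr => -[u v] /= uv; rewrite /S /=.
rewrite (eq_bigr _ (fun r adj_r => edge_covE (adj_neq _ _ uv) (adj_neq _ _ adj_r))).
rewrite !big_split /= /cond -!big_mkcondr /=.
rewrite (big_pred1 (u, v)) /=; last first.
  by move=> r /=; case: eqP => [->|]; rewrite ?uv ?andbF.
rewrite (big_pred1 (v, u)) /=; last first.
  by move=> r /=; case: eqP => [->|]; rewrite /= ?andbF // adj_sym uv.
rewrite (sum_pair_fst _ (fun r => r.2 != u)) (sum_pair_fst _ (fun r => r.2 != v)).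
rewrite (sum_pair_snd _ (fun r => r.1 != u)) (sum_pair_snd _ (fun r => r.1 != v)).
have symm (a b : G) : \sum_(w | adj w a && (w != b)) path_weight b a w =
                       \sum_(w | adj a w && (w != b)) path_weight b a w.
  by apply: eq_bigl => w; rewrite adj_sym.
rewrite /= !symm.
ring.
Qed.

End Covariance.

(** * Sums over edges and paths of functions of the degrees *)

Section DegreeSums.
Local Open Scope ring_scope.
Variables (G : sgraph) (R : nmodType).

(** Here and in [path_sum], each edge or path is met once per direction, so [F] may be
    asymmetric. *)
Definition edge_sum (F : nat -> nat -> R) : R :=
  \sum_(p : G * G | adj p.1 p.2) F (deg p.1) (deg p.2).

Definition path_sum (F : nat -> nat -> nat -> R) : R :=
  \sum_(p : G * G | adj p.1 p.2) \sum_(w | adj p.2 w && (w != p.1))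
    F (deg p.1) (deg p.2) (deg w).

Lemma path_sum_rev (F : nat -> nat -> nat -> R) :
  path_sum (fun a b c => F c b a) = path_sum F.
Proof.
rewrite /path_sum !pair_big_dep /=.
rewrite (reindex_inj (h := fun s : G * G * G => (s.2, s.1.2, s.1.1))) /=; last first.
  by move=> [[? ?] ?] [[? ?] ?] /= [-> -> ->].
apply: eq_bigl => -[[u v] w] /=.
by rewrite (adj_sym w) (adj_sym v u) eq_sym; case: (adj u v); case: (adj v w).
Qed.

End DegreeSums.

(** * Mean and variance are determined by the polynomial *)

Section Invariants.
Local Open Scope ring_scope.
Variables (K : fieldType) (x y : K).
Hypothesis xy_neq : forall d, 1 + x * y ^+ d != 0.

Definition occupation (d : nat) : K := x * y ^+ d / (1 + x * y ^+ d).

(** By [sum_deg] the weight of [A] depends only on its statistics, so [sum_set_stat] applies to the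
    moments. *)
Lemma prod_stat (G : sgraph) (A : {set G}) :
  \prod_(v in A) (x * y ^+ deg v) =
  x ^+ #|A| * y ^+ (boundary_edges A + (inner_edges A).*2).
Proof. by rewrite big_split prodr_const -sum_deg -prodrXr. Qed.

Variables G1 G2 : sgraph.
Hypothesis eqG : gen_degree_poly G1 = gen_degree_poly G2.

Lemma partition_function_eq :
  \prod_(v : G1) (1 + x * y ^+ deg v) = \prod_(v : G2) (1 + x * y ^+ deg v).
Proof.
have PE (G : sgraph) : \prod_(v : G) (1 + x * y ^+ deg v) =
    \sum_(A : {set G}) x ^+ #|A| * y ^+ (boundary_edges A + (inner_edges A).*2).
  under eq_bigr => v _ do rewrite addrC.
  rewrite bigA_distr; apply: eq_bigr => A _.
  by rewrite -prod_stat [RHS]big_mkcond.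
rewrite !PE.
exact: (sum_set_stat (fun s => x ^+ s.1.1 * y ^+ (s.1.2 + s.2.*2)) eqG).
Qed.

Lemma edge_sum_occupation_eq :
  edge_sum G1 (fun a b => occupation a * occupation b) =
  edge_sum G2 (fun a b => occupation a * occupation b).
Proof.
apply: (mulfI (x := \prod_(v : G1) (1 + x * y ^+ deg v))).
  by apply/prodf_neq0.
rewrite {2}partition_function_eq /edge_sum -!(first_moment (X := fun v => x * y ^+ deg v)) //.
under [LHS]eq_bigr => A _ do rewrite prod_stat.
under [RHS]eq_bigr => A _ do rewrite prod_stat.
exact: (sum_set_stat (fun s => s.2.*2%:R * (x ^+ s.1.1 * y ^+ (s.1.2 + s.2.*2))) eqG).
Qed.

Lemma pair_sum_occupation_eq :
  \sum_(p : G1 * G1 | adj p.1 p.2) \sum_(r : G1 * G1 | adj r.1 r.2)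
    \prod_(v in [set p.1; p.2] :|: [set r.1; r.2]) occupation (deg v) =
  \sum_(p : G2 * G2 | adj p.1 p.2) \sum_(r : G2 * G2 | adj r.1 r.2)
    \prod_(v in [set p.1; p.2] :|: [set r.1; r.2]) occupation (deg v).
Proof.
apply: (mulfI (x := \prod_(v : G1) (1 + x * y ^+ deg v))).
  by apply/prodf_neq0.
rewrite {2}partition_function_eq -!(second_moment (X := fun v => x * y ^+ deg v)) //.
under [LHS]eq_bigr => A _ do rewrite prod_stat.
under [RHS]eq_bigr => A _ do rewrite prod_stat.
exact: (sum_set_stat (fun s => s.2.*2%:R ^+ 2 * (x ^+ s.1.1 * y ^+ (s.1.2 + s.2.*2))) eqG).
Qed.

(** The variance of [2 e(A)], in the shape produced by [sum_edge_cov]. *)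
Definition cov_sum (G : sgraph) : K :=
  edge_sum G (fun a b => occupation a * occupation b
                         - (occupation a * occupation b) ^+ 2) *+ 2
  + path_sum G (fun a b c => occupation a * occupation b * occupation c
                             * (1 - occupation b)) *+ 4.

(** The variance is the second moment minus the square of the mean, and both are already
    invariant. *)
Lemma cov_sum_eq : cov_sum G1 = cov_sum G2.
Proof.
have covE (G : sgraph) : cov_sum G =
    \sum_(p : G * G | adj p.1 p.2) \sum_(r : G * G | adj r.1 r.2)
      \prod_(v in [set p.1; p.2] :|: [set r.1; r.2]) occupation (deg v)
    - edge_sum G (fun a b => occupation a * occupation b) ^+ 2.
  transitivity (\sum_(p : G * G | adj p.1 p.2) \sum_(r : G * G | adj r.1 r.2)
                  edge_cov (fun v => occupation (deg v)) p r).
    by rewrite sum_edge_cov.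
  rewrite expr2 big_distrlr -sumrB /=.
  by apply: eq_bigr => p _; rewrite -sumrB.
by rewrite !covE pair_sum_occupation_eq edge_sum_occupation_eq.
Qed.

End Invariants.

(** * The local ring of rational functions at 0 *)

Section LocalRing.
Local Open Scope ring_scope.
Variable F : fieldType.
Local Notation K := {fraction {poly F}}.
Local Notation "p %:F" := (@FracField.tofrac {poly F} p).
Local Notation t := ('X%:F : K).

(** Rational functions without a pole at [t = 0]; [vanishes k] is the ideal generated by [t ^+ k] in
    this ring. *)
Definition regular (f : K) : Prop :=
  exists N D : {poly F}, D.[0] != 0 /\ f = N%:F / D%:F.

Definition vanishes (k : nat) (f : K) : Prop :=
  exists2 r, regular r & f = t ^+ k * r.

Lemma horner0_neq0 (D : {poly F}) : D.[0] != 0 -> D%:F != 0 :> K.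
Proof. by rewrite tofrac_eq0; apply: contraNneq => ->; rewrite horner0. Qed.

Lemma regular_poly (p : {poly F}) : regular p%:F.
Proof. by exists p, 1; rewrite hornerC oner_eq0 tofrac1 divr1. Qed.

Lemma regularD (f g : K) : regular f -> regular g -> regular (f + g).
Proof.
move=> [N [D [D0 ->]]] [N' [D' [D'0 ->]]].
exists (N * D' + N' * D), (D * D'); split; first by rewrite hornerM mulf_neq0.
by rewrite addf_div ?horner0_neq0 // tofracD !tofracM.
Qed.

Lemma regularM (f g : K) : regular f -> regular g -> regular (f * g).
Proof.
move=> [N [D [D0 ->]]] [N' [D' [D'0 ->]]].
exists (N * N'), (D * D'); split; first by rewrite hornerM mulf_neq0.
by rewrite mulf_div !tofracM.
Qed.

Lemma regular_nat (n : nat) : regular n%:R.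
Proof. by rewrite -tofrac1 -tofracMn; apply: regular_poly. Qed.

Lemma regularN (f : K) : regular f -> regular (- f).
Proof.
by move=> [N [D [D0 ->]]]; exists (- N), D; rewrite tofracN mulNr.
Qed.

Lemma regularB (f g : K) : regular f -> regular g -> regular (f - g).
Proof. by move=> rf rg; apply/regularD/regularN. Qed.

Lemma regular_value (N D : {poly F}) : D.[0] != 0 ->
  vanishes 1 (N%:F / D%:F - (N.[0] / D.[0])%:P%:F).
Proof.
move=> D0; set c := N.[0] / D.[0].
(* The numerator of the difference has the root 0, which yields the factor [t]. *)
have : root (N - c *: D) 0 by rewrite rootE !hornerE /c divfK ?subrr.
move/factor_theorem => [p]; rewrite subr0 => eqN.
exists (p%:F / D%:F); first by exists p, D.
rewrite expr1 mulrA -tofracM [_ * p]mulrC -eqN.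
by rewrite tofracB -mul_polyC tofracM mulrBl mulfK ?horner0_neq0.
Qed.

Lemma vanishes0 (k : nat) : vanishes k 0.
Proof. by exists 0; [apply: (regular_nat 0)|rewrite mulr0]. Qed.

Lemma vanishesD (k : nat) (f g : K) :
  vanishes k f -> vanishes k g -> vanishes k (f + g).
Proof.
move=> [r rr ->] [s rs ->].
by exists (r + s); [apply: regularD|rewrite mulrDr].
Qed.

Lemma vanishesB (k : nat) (f g : K) :
  vanishes k f -> vanishes k g -> vanishes k (f - g).
Proof.
move=> [r rr ->] [s rs ->].
by exists (r - s); [apply: regularB|rewrite mulrBr].
Qed.

Lemma vanishesMn (k n : nat) (f : K) : vanishes k f -> vanishes k (f *+ n).
Proof.
move=> vf; elim: n => [|n IHn]; first by rewrite mulr0n; apply: vanishes0.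
by rewrite mulrS; apply: vanishesD.
Qed.

Lemma vanishes_sum (k : nat) (I : finType) (P : pred I) (f : I -> K) :
  (forall i, P i -> vanishes k (f i)) -> vanishes k (\sum_(i | P i) f i).
Proof.
by move=> vf; apply: big_ind => //; [apply: vanishes0|apply: vanishesD].
Qed.

(** Clears the denominator; since [D] has nonzero constant term, low coefficients of [p] can then be
    compared one at a time. *)
Lemma vanishes_poly (k : nat) (p : {poly F}) :
  vanishes k p%:F -> exists2 D : {poly F}, D.[0] != 0 & 'X^k %| p * D.
Proof.
move=> [_ [N [D [D0 ->]]] eqp]; exists D => //.
apply/dvdpP; exists N; apply/eqP; rewrite -tofrac_eq !tofracM tofracXn eqp.
by rewrite mulrA divfK ?horner0_neq0 // mulrC.
Qed.

Lemma vanishes_poly1 (c : F) : vanishes 1 c%:P%:F -> c = 0.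
Proof.
move=> /vanishes_poly [D D0 /dvdpP [N /(congr1 (fun p : {poly F} => p.[0]))]].
by rewrite !hornerE => /eqP; rewrite mulf_eq0 (negPf D0) orbF => /eqP.
Qed.

Lemma vanishes_poly2 (c d : F) :
  vanishes 2 (c%:P%:F + d%:P%:F * t) -> c = 0 /\ d = 0.
Proof.
rewrite -tofracM -tofracD => /vanishes_poly [D D0 /dvdpP [N eqp]].
have D00 : D`_0 != 0 by rewrite -horner_coef0.
have c0 : c = 0.
  have := congr1 (fun p : {poly F} => p`_0) eqp.
  rewrite coefMXn /= mulrDl coefD -mulrA !coefCM coefXM /= mulr0 addr0 => /eqP.
  by rewrite mulf_eq0 (negPf D00) orbF => /eqP.
split=> //; move: eqp; rewrite c0 add0r => /(congr1 (fun p : {poly F} => p`_1)).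
rewrite coefMXn /= -mulrA coefCM coefXM /= => /eqP.
by rewrite mulf_eq0 (negPf D00) orbF => /eqP.
Qed.

End LocalRing.

(** * Expansion of a single edge or path term at [t = 0] *)

Section TermExpansion.
Local Open Scope ring_scope.
Variables (K : fieldType) (t : K) (regular : K -> Prop).
Hypothesis t_neq0 : t != 0.
Hypothesis regular_t : regular t.
Hypothesis regular_1 : regular 1.
Hypothesis regular_D : forall f g, regular f -> regular g -> regular (f + g).
Hypothesis regular_M : forall f g, regular f -> regular g -> regular (f * g).
Hypothesis regular_N : forall f, regular f -> regular (- f).

Let regular_n (n : nat) : regular n%:R.
Proof.
elim: n => [|n IHn]; last by rewrite -natr1; apply: regular_D.
by rewrite mulr0n -(subrr 1); apply/regular_D/regular_N.
Qed.

Let regular_X (f : K) (n : nat) : regular f -> regular (f ^+ n).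
Proof.
by move=> rf; elim: n => // n IHn; rewrite exprS; apply: regular_M.
Qed.

(* [b] flags the factors of the degree [a] vertices, which have a pole at [t = 0];
   the other factors are regular there, with value [h]. *)
Definition expands (b : bool) (h o : K) : Prop :=
  if b then o = (t - 1) / t
  else regular o /\ exists2 r, regular r & o - h = t ^+ 1 * r.

Local Ltac regular_tac :=
  repeat first [assumption | apply: regular_n
    | apply: regular_X | apply: regular_M
    | apply: regular_D | apply: regular_N].

Variables (b1 b2 b3 : bool) (h1 h2 h3 o1 o2 o3 : K).
Hypothesis ex1 : expands b1 h1 o1.
Hypothesis ex2 : expands b2 h2 o2.
Hypothesis ex3 : expands b3 h3 o3.

Lemma edge_term_expansion :
  exists2 r, regular r & t ^+ 2 * (o1 * o2) - (b1 && b2)%:R = t ^+ 1 * r.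
Proof.
move: ex1 ex2; rewrite /expands; case: b1; case: b2 => /=.
- by move=> -> ->; exists (t - 2%:R); [regular_tac | field].
- by move=> -> [r2 _]; exists ((t - 1) * o2); [regular_tac | field].
- by move=> [r1 _] ->; exists ((t - 1) * o1); [regular_tac | field].
- by move=> [r1 _] [r2 _]; exists (t * (o1 * o2)); [regular_tac | ring].
Qed.

(** With two poles the term times [t ^+ 4] is [t^2 (t-1)^2 - (t-1)^4], whence the coefficients -1
    and 4. With at most one pole it is already a multiple of [t ^+ 2]. *)
Lemma edge_sq_term_expansion :
  exists2 r, regular r &
  t ^+ 4 * (o1 * o2 - (o1 * o2) ^+ 2)
  - (- (b1 && b2)%:R + 4%:R * (b1 && b2)%:R * t) = t ^+ 2 * r.
Proof.
move: ex1 ex2; rewrite /expands; case: b1; case: b2 => /=.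
- move=> -> ->; exists ((t - 1) ^+ 2 - t ^+ 2 + 4%:R * t - 6%:R).
    by regular_tac.
  by field.
- move=> -> [r2 _]; exists (t * (t - 1) * o2 - (t - 1) ^+ 2 * o2 ^+ 2).
    by regular_tac.
  by field.
- move=> [r1 _] ->; exists (t * (t - 1) * o1 - (t - 1) ^+ 2 * o1 ^+ 2).
    by regular_tac.
  by field.
- move=> [r1 _] [r2 _]; exists (t ^+ 2 * (o1 * o2 - (o1 * o2) ^+ 2)).
    by regular_tac.
  by ring.
Qed.

(** A flagged centre has [1 - o2 = 1/t], one extra pole. Three flags give
    [(t-1)^3 = -1 + 3 t - ...]; a flagged centre and one flagged end give [t (t-1)^2] times the
    other factor, of value [h]. All other cases have a pole of order at most two. *)
Lemma path_term_expansion :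
  exists2 r, regular r &
  t ^+ 4 * (o1 * o2 * o3 * (1 - o2))
  - (- [&& b1, b2 & b3]%:R
     + (3%:R * [&& b1, b2 & b3]%:R + [&& b1, b2 & ~~ b3]%:R * h3
        + [&& ~~ b1, b2 & b3]%:R * h1) * t) = t ^+ 2 * r.
Proof.
move: ex1 ex2 ex3; rewrite /expands; case: b2.
  case: b1; case: b3 => /=.
  - by move=> -> -> ->; exists (t - 3%:R); [regular_tac | field].
  - move=> -> -> [r3 [s rs es]]; exists ((t - 2%:R) * o3 + s).
      by regular_tac.
    have -> : o3 = h3 + t * s by rewrite -[t]expr1 -es addrC subrK.
    by field.
  - move=> [r1 [s rs es]] -> ->; exists ((t - 2%:R) * o1 + s).
      by regular_tac.
    have -> : o1 = h1 + t * s by rewrite -[t]expr1 -es addrC subrK.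
    by field.
  - by move=> [r1 _] -> [r3 _]; exists ((t - 1) * o1 * o3); [regular_tac | field].
case: b1; case: b3 => /= e1 [r2 _] e3.
- rewrite e1 e3; exists ((t - 1) ^+ 2 * (o2 * (1 - o2))); first by regular_tac.
  by field.
- case: e3 => r3 _; rewrite e1; exists (t * (t - 1) * o3 * (o2 * (1 - o2))).
    by regular_tac.
  by field.
- case: e1 => r1 _; rewrite e3; exists (t * (t - 1) * o1 * (o2 * (1 - o2))).
    by regular_tac.
  by field.
- case: e1 => r1 _; case: e3 => r3 _.
  exists (t ^+ 2 * o1 * o3 * (o2 * (1 - o2))); first by regular_tac.
  by ring.
Qed.

End TermExpansion.

(** * Poles of mean and variance at the degree [a] vertices *)

Section PoleExpansion.
Local Open Scope ring_scope.
Variables (F : fieldType) (q : F) (a : nat).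
Hypothesis q_neq : forall d, d != a -> q ^+ d != q ^+ a.
Hypothesis q_neq0 : q != 0.
Local Notation K := {fraction {poly F}}.
Local Notation "p %:F" := (@FracField.tofrac {poly F} p).
Local Notation t := ('X%:F : K).

(** Chosen so that [1 + x * y ^+ a = t]. *)
Let x : K := ('X - 1)%:F / (q ^+ a)%:P%:F.
Let y : K := q%:P%:F.
Local Notation occ := (occupation x y).

(* The value of [occ d] at [t = 0] for [d != a]; for [d = a] the division by zero
   makes it [0]. *)
Definition occ_value (d : nat) : F := q ^+ d / (q ^+ d - q ^+ a).

Let N (d : nat) : {poly F} := ('X - 1) * (q ^+ d / q ^+ a)%:P.

Lemma xyE (d : nat) : x * y ^+ d = (N d)%:F.
Proof.
have qa0 : (q ^+ a)%:P%:F != 0 :> K by rewrite tofrac_eq0 polyC_eq0 expf_neq0.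
rewrite /x /y -tofracXn -rmorphXn mulrAC -tofracM.
apply: (mulIf qa0); rewrite divfK // -tofracM /N -mulrA -polyCM divfK //.
exact: expf_neq0.
Qed.

Lemma horner_N (d : nat) (z : F) : (N d).[z] = (z - 1) * (q ^+ d / q ^+ a).
Proof. by rewrite hornerM hornerXsubC hornerC. Qed.

Lemma xy_neq0 (d : nat) : 1 + x * y ^+ d != 0.
Proof.
rewrite xyE -tofrac1 -tofracD tofrac_eq0.
(* At [t = 1] the variable [x] is 0, so the value there is 1. *)
apply/eqP => /(congr1 (fun p : {poly F} => p.[1])) /eqP.
by rewrite hornerD hornerC horner_N subrr mul0r addr0 horner0 oner_eq0.
Qed.

Lemma occE (d : nat) : occ d = (N d)%:F / (1 + N d)%:F.
Proof. by rewrite /occupation xyE tofracD tofrac1. Qed.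

Lemma t_neq0 : t != 0. Proof. by rewrite tofrac_eq0 polyX_eq0. Qed.

Lemma occ_pole : occ a = (t - 1) / t.
Proof.
have NE : N a = 'X - 1 by rewrite /N divff ?expf_neq0 // mulr1.
by rewrite occE NE [1 + _]addrC subrK tofracB tofrac1.
Qed.

Lemma occ_regular (d : nat) : d != a ->
  regular (occ d) /\ vanishes 1 (occ d - (occ_value d)%:P%:F).
Proof.
move=> /q_neq qda.
have qa0 : q ^+ a != 0 by apply: expf_neq0.
have D0 : (1 + N d).[0] = (q ^+ a - q ^+ d) / q ^+ a.
  by rewrite hornerD hornerC horner_N; field.
have D0n : (1 + N d).[0] != 0.
  by rewrite D0 mulf_neq0 ?invr_eq0 // subr_eq0 eq_sym.
rewrite occE; split; first by exists (N d), (1 + N d).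
suff -> : occ_value d = (N d).[0] / (1 + N d).[0] by apply: regular_value.
have dif : q ^+ d - q ^+ a != 0 by rewrite subr_eq0.
rewrite D0 horner_N /occ_value; field.
by rewrite qa0 dif -opprB oppr_eq0 dif.
Qed.

Local Notation cst c := (c%:P%:F).

Lemma cstD (c d : F) : cst (c + d) = cst c + cst d :> K.
Proof. by rewrite polyCD tofracD. Qed.

Lemma cstMn (c : F) (n : nat) : cst (c *+ n) = cst c *+ n :> K.
Proof. by rewrite polyCMn tofracMn. Qed.

Lemma cst_nat (n : nat) : cst n%:R = n%:R :> K.
Proof. by rewrite cstMn polyC1 tofrac1. Qed.

Lemma cst_natl (n : nat) (c : F) : cst (n%:R * c) = n%:R * cst c :> K.
Proof. by rewrite polyCM tofracM cst_nat. Qed.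

Lemma cst_sum (I : finType) (P : pred I) (c : I -> F) :
  cst (\sum_(i | P i) c i) = \sum_(i | P i) cst (c i) :> K.
Proof. by rewrite !rmorph_sum. Qed.

Lemma occ_expands (d : nat) :
  expands t (@regular F) (d == a) (cst (occ_value d)) (occ d).
Proof.
by rewrite /expands; case: eqVneq => [->|/occ_regular//]; apply: occ_pole.
Qed.

Let regular_t : regular t := regular_poly 'X.
Let regular_1 : regular (1 : K) := regular_nat F 1.

Lemma edge_sum_expansion (G : sgraph) :
  vanishes 1 (t ^+ 2 * edge_sum G (fun d e => occ d * occ e)
              - cst (edge_sum G (fun d e => ((d == a) && (e == a))%:R))).
Proof.
rewrite /edge_sum cst_sum mulr_sumr -sumrB; apply: vanishes_sum => p _.
rewrite cst_nat; apply: edge_term_expansion (occ_expands _) (occ_expands _) => //.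
- exact: t_neq0.
- exact: regularD.
- exact: regularM.
- exact: regularN.
Qed.

(** These four are the contributions of one edge or path term to the coefficients of [t^-4] (index
    0) and [t^-3] (index 1). *)
Definition edge_coef0 (d e : nat) : F := - ((d == a) && (e == a))%:R.
Definition edge_coef1 (d e : nat) : F := 4%:R * ((d == a) && (e == a))%:R.
Definition path_coef0 (d c e : nat) : F := - [&& d == a, c == a & e == a]%:R.
Definition path_coef1 (d c e : nat) : F :=
  3%:R * [&& d == a, c == a & e == a]%:R
  + [&& d == a, c == a & e != a]%:R * occ_value e
  + [&& d != a, c == a & e == a]%:R * occ_value d.

Lemma edge_sq_sum_expansion (G : sgraph) :
  vanishes 2 (t ^+ 4 * edge_sum G (fun d e => occ d * occ e - (occ d * occ e) ^+ 2)
    - (cst (edge_sum G edge_coef0) + cst (edge_sum G edge_coef1) * t)).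
Proof.
rewrite /edge_sum !cst_sum mulr_sumr mulr_suml -big_split -sumrB /=.
apply: vanishes_sum => p _.
rewrite /edge_coef0 /edge_coef1 polyCN tofracN cst_natl !cst_nat.
apply: edge_sq_term_expansion (occ_expands _) (occ_expands _) => //.
- exact: t_neq0.
- exact: regularD.
- exact: regularM.
- exact: regularN.
Qed.

Lemma path_sum_expansion (G : sgraph) :
  vanishes 2 (t ^+ 4 * path_sum G (fun d c e => occ d * occ c * occ e * (1 - occ c))
    - (cst (path_sum G path_coef0) + cst (path_sum G path_coef1) * t)).
Proof.
rewrite /path_sum !cst_sum mulr_sumr mulr_suml -big_split -sumrB /=.
apply: vanishes_sum => p _.
rewrite !cst_sum mulr_sumr mulr_suml -big_split -sumrB /=.
apply: vanishes_sum => w _.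
rewrite /path_coef0 /path_coef1 polyCN tofracN !cstD !cst_natl !cst_nat.
apply: path_term_expansion (occ_expands _) (occ_expands _) (occ_expands _) => //.
- exact: t_neq0.
- exact: regularD.
- exact: regularM.
- exact: regularN.
Qed.

(** This and the next two are pure rearrangements, stated over any ring so that [ring] meets only
    variables. *)
Let combine_expansions (R : comNzRingType) (s T A B C A' B' C' : R) :
  T * (A *+ 2 + A' *+ 4) - (B *+ 2 + B' *+ 4 + (C *+ 2 + C' *+ 4) * s) =
  (T * A - (B + C * s)) *+ 2 + (T * A' - (B' + C' * s)) *+ 4.
Proof. by ring. Qed.

Let sub_expansions (R : comNzRingType) (f c c' : R) :
  f - c - (f - c') = c' - c.
Proof. by ring. Qed.

Let sub_expansions2 (R : comNzRingType) (s f b c b' c' : R) :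
  f - (b + c * s) - (f - (b' + c' * s)) = b' - b + (c' - c) * s.
Proof. by ring. Qed.

Lemma cov_sum_expansion (G : sgraph) :
  vanishes 2 (t ^+ 4 * cov_sum x y G
    - (cst (edge_sum G edge_coef0 *+ 2 + path_sum G path_coef0 *+ 4)
       + cst (edge_sum G edge_coef1 *+ 2 + path_sum G path_coef1 *+ 4) * t)).
Proof.
have := vanishesD (vanishesMn 2 (edge_sq_sum_expansion G))
                  (vanishesMn 4 (path_sum_expansion G)).
rewrite (cstD (edge_sum G edge_coef0 *+ 2)) (cstD (edge_sum G edge_coef1 *+ 2)).
rewrite !cstMn /cov_sum.
by rewrite combine_expansions.
Qed.

Variables G1 G2 : sgraph.
Hypothesis eqG : gen_degree_poly G1 = gen_degree_poly G2.

(** Subtracting the expansions of the two graphs cancels the common mean; the remaining constant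
    vanishes at [t = 0], hence is 0. [cov_coef_eq] treats the variance likewise. *)
Lemma edge_count_eq :
  edge_sum G1 (fun d e => ((d == a) && (e == a))%:R) =
  edge_sum G2 (fun d e => ((d == a) && (e == a))%:R) :> F.
Proof.
apply/eqP; rewrite -subr_eq0; apply/eqP/vanishes_poly1.
have := vanishesB (edge_sum_expansion G2) (edge_sum_expansion G1).
rewrite (edge_sum_occupation_eq xy_neq0 eqG) polyCB tofracB.
by rewrite sub_expansions.
Qed.

Lemma cov_coef_eq :
  edge_sum G1 edge_coef0 *+ 2 + path_sum G1 path_coef0 *+ 4 =
  edge_sum G2 edge_coef0 *+ 2 + path_sum G2 path_coef0 *+ 4 /\
  edge_sum G1 edge_coef1 *+ 2 + path_sum G1 path_coef1 *+ 4 =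
  edge_sum G2 edge_coef1 *+ 2 + path_sum G2 path_coef1 *+ 4.
Proof.
have := vanishesB (cov_sum_expansion G2) (cov_sum_expansion G1).
rewrite (cov_sum_eq xy_neq0 eqG) sub_expansions2 -!tofracB -!polyCB.
by move=> /vanishes_poly2 [/eqP + /eqP]; rewrite !subr_eq0 => /eqP + /eqP.
Qed.

End PoleExpansion.

(** * Isolating the weighted count of paths (a,a,b) *)

Section PoleCoefficient.
Local Open Scope ring_scope.
Variables (q : rat) (a : nat).
Hypothesis q_neq : forall d, d != a -> q ^+ d != q ^+ a.
Hypothesis q_neq0 : q != 0.
Variables G1 G2 : sgraph.
Hypothesis eqG : gen_degree_poly G1 = gen_degree_poly G2.

Definition pole_weight (d c e : nat) : rat :=
  [&& d == a, c == a & e != a]%:R * occ_value q a e.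

Lemma edge_sumZ (G : sgraph) (k : rat) (f : nat -> nat -> rat) :
  edge_sum G (fun d e => k * f d e) = k * edge_sum G f.
Proof. by rewrite /edge_sum mulr_sumr. Qed.

Lemma path_sumZ (G : sgraph) (k : rat) (f : nat -> nat -> nat -> rat) :
  path_sum G (fun d c e => k * f d c e) = k * path_sum G f.
Proof.
by rewrite /path_sum mulr_sumr; apply: eq_bigr => p _; rewrite mulr_sumr.
Qed.

Lemma path_sumD (G : sgraph) (f g : nat -> nat -> nat -> rat) :
  path_sum G (fun d c e => f d c e + g d c e) = path_sum G f + path_sum G g.
Proof.
by rewrite /path_sum -big_split; apply: eq_bigr => p _; rewrite -big_split.
Qed.

Lemma eq_path_sum (G : sgraph) (R : nmodType) (f g : nat -> nat -> nat -> R) :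
  (forall d c e, f d c e = g d c e) -> path_sum G f = path_sum G g.
Proof.
by move=> fg; apply: eq_bigr => p _; apply: eq_bigr => w _.
Qed.

(** A triangular system: the mean gives the (a,a) edges, then [t^-4] in the variance gives the
    (a,a,a) paths, and [t^-3] leaves the weighted sum. *)
Lemma pole_sum_eq : path_sum G1 pole_weight = path_sum G2 pole_weight.
Proof.
have e0 (G : sgraph) : edge_sum G (edge_coef0 rat a) =
    -1 * edge_sum G (fun d e => ((d == a) && (e == a))%:R).
  by rewrite -edge_sumZ; apply: eq_bigr => p _; rewrite mulN1r.
have e1 (G : sgraph) : edge_sum G (edge_coef1 rat a) =
    4%:R * edge_sum G (fun d e => ((d == a) && (e == a))%:R).
  by rewrite -edge_sumZ.
pose b3 (d c e : nat) : rat := [&& d == a, c == a & e == a]%:R.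
have p0 (G : sgraph) : path_sum G (path_coef0 rat a) = -1 * path_sum G b3.
  by rewrite -path_sumZ; apply: eq_path_sum => d c e; rewrite mulN1r.
have p1 (G : sgraph) : path_sum G (path_coef1 q a) =
    3%:R * path_sum G b3 + path_sum G pole_weight *+ 2.
  (* One of the two copies is reversed, to account for the paths whose first vertex has degree other
     than [a]. *)
  rewrite mulr2n -{2}(path_sum_rev _ pole_weight) -path_sumZ addrA -!path_sumD.
  apply: eq_path_sum => d c e; rewrite /path_coef1 /pole_weight /b3.
  by case: (d == a); case: (c == a); case: (e == a).
have := edge_count_eq q_neq q_neq0 eqG.
have [] := cov_coef_eq q_neq q_neq0 eqG.
rewrite !e0 !e1 !p0 !p1 => c0 c1 e.
lra.
Qed.

End PoleCoefficient.

(** * Linear independence of 1 and the functions [q^m / (1 - q^m)] *)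

Section LambertIndependence.
Local Open Scope ring_scope.
Import Num.Theory.

Lemma poly_eq0_nat (p : {poly rat}) :
  (forall n : nat, (1 < n)%N -> p.[n%:R] = 0) -> p = 0.
Proof.
move=> p0; apply/eqP; apply: contraT => /max_poly_roots max_p.
have := max_p [seq n%:R | n <- iota 2 (size p)].
rewrite size_map size_iota ltnn; apply.
  by apply/allP => _ /mapP [n + ->]; rewrite mem_iota => /andP [n2 _]; apply/rootP/p0.
by rewrite map_inj_uniq ?iota_uniq // => m n /eqP; rewrite eqr_nat => /eqP.
Qed.

(** Multiplying by [D], the product of all denominators, gives a polynomial with infinitely many
    roots, so all its coefficients are 0. The constant one is [C]. *)
Lemma lambert_independence (M : nat) (C : rat) (c : nat -> rat) :
  (forall n : nat, (1 < n)%N ->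
     C + \sum_(1 <= m < M) c m * (n%:R ^+ m / (1 - n%:R ^+ m)) = 0) ->
  C = 0 /\ (forall m, (1 <= m < M)%N -> c m = 0).
Proof.
move=> eq0.
pose Q (m : nat) : {poly rat} := \prod_(1 <= j < M | j != m) (1 - 'X^j).
pose D : {poly rat} := \prod_(1 <= j < M) (1 - 'X^j).
pose p := C%:P * D + \sum_(1 <= m < M) (c m)%:P * ('X^m * Q m).
have Q0 m : (Q m).[0] = 1.
  rewrite /Q horner_prod big_nat_cond big1 // => j /andP [/andP [j0 _] _].
  by rewrite !hornerE; case: j j0 => // j _; rewrite expr0n subr0.
have p0 : p = 0.
  apply: poly_eq0_nat => n n1.
  have n_neq m : (0 < m)%N -> 1 - n%:R ^+ m != 0 :> rat.
    move=> m0; rewrite subr_eq0 eq_sym -natrX pnatr_eq1 gtn_eqF //.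
    by rewrite -[1%N](exp1n m) ltn_exp2r.
  have -> : p.[n%:R] = D.[n%:R] *
      (C + \sum_(1 <= m < M) c m * (n%:R ^+ m / (1 - n%:R ^+ m))).
    rewrite /p hornerD hornerM hornerC mulrC mulrDr horner_sum mulr_sumr.
    congr (_ + _); rewrite !big_seq; apply: eq_bigr => m.
    rewrite mem_index_iota => mM; rewrite !hornerM hornerC hornerXn.
    have -> : D.[n%:R] = (1 - n%:R ^+ m) * (Q m).[n%:R].
      rewrite /D (bigD1_seq m) ?iota_uniq ?mem_index_iota //=.
      by rewrite hornerM !hornerE.
    by field; rewrite n_neq //; case/andP: mM.
  by rewrite eq0 // mulr0.
have C0 : C = 0.
  have := congr1 (fun p : {poly rat} => p.[0]) p0.
  rewrite /p hornerD hornerM hornerC horner_sum horner0.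
  have -> : D.[0] = 1.
    rewrite /D horner_prod big_nat_cond big1 // => j /andP [/andP [j0 _] _].
    by rewrite !hornerE; case: j j0 => // j _; rewrite expr0n subr0.
  rewrite big_nat_cond big1 ?mulr1 ?addr0 // => m /andP [/andP [m0 _] _].
  by rewrite !hornerM hornerXn expr0n -(prednK m0) mul0r mulr0.
(* In the coefficient of ['X^m], terms with [j < m] are 0 by induction and those with [j > m] start
   too late; what is left is [c m] times the constant term 1 of [Q m]. *)
split=> // m; elim/ltn_ind: m => m IHm /andP [m0 mM].
have := congr1 (fun p : {poly rat} => p`_m) p0.
rewrite /p C0 polyC0 mul0r add0r coef_sum coef0.
rewrite (bigD1_seq m) ?iota_uniq ?mem_index_iota ?m0 //= big_seq_cond big1.
  by rewrite addr0 coefCM coefXnM ltnn subnn -horner_coef0 Q0 mulr1.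
move=> j /andP []; rewrite mem_index_iota coefCM coefXnM => /andP [j0 jM] jm.
have [mj|jltm] := ltnP m j; first by rewrite mulr0.
rewrite IHm ?mul0r ?j0 // ltn_neqAle jm; exact: jltm.
Qed.

End LambertIndependence.

(** * From weighted path sums to path counts *)

Section PathCounts.
Local Open Scope ring_scope.
Import Num.Theory.

Lemma card_deg_paths (G : sgraph) (a1 a2 a3 : nat) (R : pzSemiRingType) :
  #|deg_paths G a1 a2 a3|%:R =
  path_sum G (fun d c e => [&& d == a1, c == a2 & e == a3]%:R) :> R.
Proof.
rewrite /path_sum pair_big_dep /= -sum1_card natr_sum big_mkcond [RHS]big_mkcond.
apply: eq_bigr => -[[u v] w] _ /=; rewrite !inE /= andbT.
have [uv|] := boolP (adj u v); last by rewrite /= andbF.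
have [vw|] := boolP (adj v w); last by rewrite /= andbF.
have adj_neq (x z : G) : adj x z -> x != z.
  by move=> xz; apply: contraTneq xz => ->; rewrite adj_irrefl.
(* Adjacency gives two of the three inequalities in [uniq]; only [w != u] remains. *)
rewrite !inE (negPf (adj_neq _ _ uv)) (negPf (adj_neq _ _ vw)) /= [w == u]eq_sym andbT.
by case: eqP => //= _; case: [&& _, _ & _].
Qed.

(** An end of a path has a neighbour. This disposes of the index 0, which enters the constant term
    and is the mirror image of [b = 2 * a]. *)
Lemma deg_paths_end0 (G : sgraph) (a1 a2 : nat) : #|deg_paths G a1 a2 0%N| = 0%N.
Proof.
apply: eq_card0 => -[[u v] w]; rewrite !inE; apply/negP.
case/and5P => _ _ vw _ /andP [_ ]; rewrite /deg cards_eq0 => /eqP w0.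
by have := in_set0 v; rewrite -w0 inE adj_sym vw.
Qed.

Lemma deg_le_card (G : sgraph) (v : G) : (deg v <= #|G|)%N.
Proof. exact: max_card. Qed.

Lemma pole_sumE (q : rat) (a B : nat) (G : sgraph) : (#|G| < B)%N ->
  path_sum G (pole_weight q a) =
  \sum_(0 <= b < B | b != a) #|deg_paths G a a b|%:R * occ_value q a b.
Proof.
move=> GB.
under [RHS]eq_bigr => b _ do rewrite card_deg_paths /path_sum mulr_suml.
rewrite exchange_big; apply: eq_bigr => p _ /=.
under [RHS]eq_bigr => b _ do rewrite mulr_suml.
rewrite exchange_big; apply: eq_bigr => w _ /=.
have wB : (deg w < B)%N by apply: leq_ltn_trans (deg_le_card w) GB.
rewrite big_mkcond (bigD1_seq (deg w)) ?iota_uniq ?mem_index_iota //=.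
rewrite [X in _ + X]big1 ?addr0 /pole_weight => [|b bw]; last first.
  by rewrite [deg w == b]eq_sym (negPf bw) !andbF mul0r if_same.
by case: (deg w == a); rewrite ?andbF ?mul0r //= eqxx.
Qed.

(** Degrees are paired by their distance [m] from [a]. The factor [(m <= a)] guards the truncated
    subtraction [a - m]. *)
Lemma pole_sum_lambert (q : rat) (a M : nat) (c : nat -> rat) :
  (forall m, (0 < m)%N -> 1 - q ^+ m != 0) -> q != 0 -> (a < M)%N ->
  \sum_(0 <= b < a + M | b != a) c b * occ_value q a b =
  \sum_(0 <= b < a) c b + \sum_(1 <= m < M)
    ((m <= a)%N%:R * c (a - m)%N - c (a + m)%N) * (q ^+ m / (1 - q ^+ m)).
Proof.
move=> q1 q0 aM.
have qX m : q ^+ m != 0 by apply: expf_neq0.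
have below m : (0 < m <= a)%N ->
    c (a - m)%N * occ_value q a (a - m) =
    c (a - m)%N + c (a - m)%N * (q ^+ m / (1 - q ^+ m)).
  move=> /andP [m0 ma]; have qa : q ^+ a = q ^+ (a - m) * q ^+ m by rewrite -exprD subnK.
  rewrite /occ_value qa.
  field; rewrite q1 //= -[X in X - _]mulr1 -mulrBr mulf_neq0 ?q1 //.
have above m : (0 < m)%N ->
    c (a + m)%N * occ_value q a (a + m) = - c (a + m)%N * (q ^+ m / (1 - q ^+ m)).
  move=> m0; rewrite /occ_value exprD.
  field; rewrite q1 //= -[X in _ - X]mulr1 -mulrBr mulf_neq0 ?qX //.
  by rewrite -opprB oppr_eq0 q1.
have rev (F : nat -> rat) :
    \sum_(0 <= b < a) F b = \sum_(1 <= m < a.+1) F (a - m)%N.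
  by rewrite big_nat_rev big_add1 /=; apply: eq_bigr => i _; rewrite add0n.
have -> : \sum_(0 <= b < a + M | b != a) c b * occ_value q a b =
    \sum_(0 <= b < a) c b * occ_value q a b
    + \sum_(1 <= m < M) c (a + m)%N * occ_value q a (a + m).
  rewrite (big_cat_nat (n := a)) ?leq_addr //=.
  congr (_ + _).
    by rewrite big_nat_cond [RHS]big_nat_cond; apply: eq_bigl => b; lia.
  rewrite big_ltn_cond; last by lia.
  rewrite eqxx /= -add1n big_addn addKn big_nat_cond [RHS]big_nat_cond.
  by apply: eq_big => [m|m _]; [lia | rewrite addnC].
have sum_below : \sum_(0 <= b < a) c b * occ_value q a b =
    \sum_(0 <= b < a) c b
    + \sum_(1 <= m < M) (m <= a)%N%:R * c (a - m)%N * (q ^+ m / (1 - q ^+ m)).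
  rewrite (big_cat_nat (n := a.+1) (p := M)) //= [X in _ = _ + (_ + X)]big_nat_cond.
  rewrite [X in _ = _ + (_ + X)]big1 ?addr0 => [|m]; last first.
    by rewrite andbT => /andP [am _]; rewrite leqNgt am !mul0r.
  rewrite !rev -big_split /= !big_nat; apply: eq_bigr => m mr.
  by rewrite below // -ltnS; case/andP: mr => _ ->; rewrite mul1r.
rewrite sum_below -addrA -big_split /=; congr (_ + _); rewrite !big_nat.
by apply: eq_bigr => m /andP [m0 _]; rewrite above // mulrBl mulNr.
Qed.

End PathCounts.

(** * Reading off the three claims *)

Section PathCountDifferences.
Local Open Scope ring_scope.
Import Num.Theory.
Variables (a : nat) (G1 G2 : sgraph).
Hypothesis eqG : gen_degree_poly G1 = gen_degree_poly G2.

Let path_diff (b : nat) : rat :=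
  #|deg_paths G1 a a b|%:R - #|deg_paths G2 a a b|%:R.

Let path_diff_eq0 (b : nat) :
  path_diff b = 0 -> #|deg_paths G1 a a b| = #|deg_paths G2 a a b|.
Proof. by move=> /eqP; rewrite subr_eq0 eqr_nat => /eqP. Qed.

(** Every integer [n > 1] is an admissible [q], its powers being distinct; [M] only has to be large
    enough for all degrees to lie below [a + M]. *)
Lemma path_diff_lambert (M : nat) :
  (a < M)%N -> (#|G1| < a + M)%N -> (#|G2| < a + M)%N ->
  \sum_(0 <= b < a) path_diff b = 0 /\
  (forall m, (1 <= m < M)%N ->
     (m <= a)%N%:R * path_diff (a - m)%N - path_diff (a + m)%N = 0).
Proof.
move=> aM G1M G2M; apply: lambert_independence => n n1.
have n0 : n%:R != 0 :> rat by rewrite pnatr_eq0 -lt0n ltnW.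
have nX d e : (n%:R ^+ d == n%:R ^+ e :> rat) = (d == e).
  by rewrite -!natrX eqr_nat eqn_exp2l.
rewrite -pole_sum_lambert //; last first.
  by move=> m m0; rewrite subr_eq0 -(expr0 n%:R) nX eq_sym -lt0n.
under eq_bigr => b _ do rewrite mulrBl.
rewrite sumrB -!pole_sumE //; apply/eqP; rewrite subr_eq0; apply/eqP.
by apply: pole_sum_eq => // d; rewrite nX.
Qed.

Lemma sum_deg_paths_eq :
  (\sum_(1 <= b < a) #|deg_paths G1 a a b| =
   \sum_(1 <= b < a) #|deg_paths G2 a a b|)%N.
Proof.
have [||| + _] := @path_diff_lambert (a + #|G1| + #|G2|).+1; try lia.
have [->|a_gt0] := posnP a; first by rewrite !big_geq.
rewrite (big_ltn a_gt0) /path_diff !deg_paths_end0 subrr add0r sumrB => /eqP.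
by rewrite subr_eq0 -!natr_sum eqr_nat => /eqP.
Qed.

Lemma deg_paths_reflect_eq (k : nat) : (1 <= k <= a)%N ->
  #|deg_paths G1 a a (a - k)|%:Z - #|deg_paths G1 a a (a + k)|%:Z =
  #|deg_paths G2 a a (a - k)|%:Z - #|deg_paths G2 a a (a + k)|%:Z.
Proof.
move=> /andP [k0 ka].
have [||| _ /(_ k)] := @path_diff_lambert (a + #|G1| + #|G2|).+1; try lia.
rewrite k0 ka mul1r /path_diff => e; have {}e := e ltac:(lia).
have {}e : #|deg_paths G1 a a (a - k)|%:R - #|deg_paths G1 a a (a + k)|%:R =
           #|deg_paths G2 a a (a - k)|%:R - #|deg_paths G2 a a (a + k)|%:R :> rat.
  by have := e; lra.
by apply: (@intr_inj rat); rewrite !rmorphB /= !pmulrn in e *.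
Qed.

(** For [m = b - a >= a] the mirror degree [a - m] is negative or 0, so the coefficient at [m]
    involves degree [b] alone. *)
Lemma deg_paths_far_eq (b : nat) : (0 < a)%N -> (2 * a <= b)%N ->
  #|deg_paths G1 a a b| = #|deg_paths G2 a a b|.
Proof.
move=> a0 ab; apply: path_diff_eq0.
have [||| _ /(_ (b - a)%N)] := @path_diff_lambert (b + #|G1| + #|G2|).+1; try lia.
have -> : (a + (b - a) = b)%N by lia.
have -> : (b - a <= a)%N%:R * path_diff (a - (b - a))%N = 0.
  have [le|] := leqP (b - a) a; last by rewrite mul0r.
  have -> : (a - (b - a) = 0)%N by lia.
  by rewrite /path_diff !deg_paths_end0 subrr mulr0.
rewrite sub0r => e; apply/eqP; rewrite -oppr_eq0; apply/eqP/e.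
by lia.
Qed.

End PathCountDifferences.

Theorem theorem4p8 (a : nat) (ha : 2 <= a) (T1 T2 : sgraph)
    (hT1 : is_tree T1) (hT2 : is_tree T2)
    (hG : gen_degree_poly T1 = gen_degree_poly T2) :
  [/\ \sum_(1 <= b < a) Npaths a a b T1 = \sum_(1 <= b < a) Npaths a a b T2,
      forall k : nat, 1 <= k <= a - 1 ->
        ((Npaths a a (a - k) T1)%:Z - (Npaths a a (a + k) T1)%:Z)%R =
        ((Npaths a a (a - k) T2)%:Z - (Npaths a a (a + k) T2)%:Z)%R
    & forall b : nat, 2 * a <= b -> Npaths a a b T1 = Npaths a a b T2].
Proof.
(* All end degrees in the claims differ from [a], so no path is identified with its reversal. *)
have NpathsE (T : sgraph) (b : nat) :
    a != b -> Npaths a a b T = #|deg_paths T a a b|.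
  by rewrite /Npaths => /negPf ->.
split.
- have sumE (T : sgraph) : \sum_(1 <= b < a) Npaths a a b T =
      \sum_(1 <= b < a) #|deg_paths T a a b|.
    by rewrite !big_nat; apply: eq_bigr => b ?; apply: NpathsE; lia.
  by rewrite !sumE; apply: sum_deg_paths_eq.
- move=> k hk; rewrite !NpathsE; try lia.
  by apply: deg_paths_reflect_eq => //; lia.
- move=> b hb; rewrite !NpathsE; try lia.
  by apply: deg_paths_far_eq => //; lia.
Qed.
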